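(* For $n\ge1$ let $\tilde\Lambda_n=(-1)^{n+1}\Lambda_n$, and regard $\boldsymbol\Lambda=\{\tilde\Lambda_1,\tilde\Lambda_2,\dots,\tilde\Lambda_n,\dots\}$ as an alphabet with weight function $\omega(\tilde\Lambda_n)=n$. Then $$\mathcal F(\boldsymbol\Lambda,\omega)=(Q_1[\boldsymbol\Lambda],Q_2[\boldsymbol\Lambda],\dots)=(Q_1,Q_2,\dots),$$ where each component code of the factorization $\mathcal F(\boldsymbol\Lambda,\omega)$ is identified with its characteristic series; that is, for each $i\ge 1$, the noncommutative Witt symmetric function $Q_i\in\mathbf{Sym}$ is the sum of the words (in the letters $\tilde\Lambda_n$) of the $i$-th code of $\mathcal F(\boldsymbol\Lambda,\omega)$.
   Context: Noncommutative symmetric functions: $\mathbf{Sym}=\mathbb Q\langle\Lambda_1,\Lambda_2,\dots\rangle$ is the free associative algebra on generators $\Lambda_n$ of degree $n$ (elementary functions), with $\Lambda_0=1$. The complete functions $S_n$ ($S_0=1$) are defined by $\sigma_t=\sum_{n\ge 0}S_nt^n=\left(\sum_{k\ge 0}(-t)^k\Lambda_k\right)^{-1}$, where $t$ is a central variable. The noncommutative Witt symmetric functions $Q_n\in\mathbf{Sym}$ ($Q_n$ of degree $n$) are defined by $$\frac1{1-tQ_1}\,\frac1{1-t^2Q_2}\,\frac1{1-t^3Q_3}\cdots=\sum_{n\ge 0}t^nS_n ,$$ the product being taken from left to right in increasing order of $n$. The characteristic series of a set of words $S$ is $\underline S=\sum_{w\in S}w$. Since the $\tilde\Lambda_n$ are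 free generators of $\mathbf{Sym}$, words over $\boldsymbol\Lambda$ are identified with monomials in $\mathbf{Sym}$. The series $\sigma_1$ is then the characteristic series of the free monoid $\boldsymbol\Lambda^*$. The notation $Q_i[\boldsymbol\Lambda]$ denotes the specialization of $Q_i$ at the code $\boldsymbol\Lambda$ whose degree-$n$ part is $\{\tilde\Lambda_n\}$, i.e. the image of $Q_i$ under the algebra morphism sending $\Lambda_n$ to $(-1)^{n-1}\tilde\Lambda_n$. Weight factorizations: let $B$ be an alphabet (possibly infinite) and $\omega:B\to\mathbb N\setminus\{0\}$ a weight function, extended to a monoid morphism $\omega:B^*\to(\mathbb N,+)$. Define sequences of codes $(Z_i)_{i\ge1}$ and $(D_i)_{i\ge1}$ in $B^*$ by $Z_1=B$; $D_i=Z_i\cap\{w\in B^*:\omega(w)=i\}$ for each $i>0$; and $Z_{i+1}=(Z_i\setminus D_i)D_i^*$ for each $i>0$. Then $\mathcal F(B,\omega)$ denotes the sequence obtained from $(D_i)_{i\ge1}$ by omitting the empty sets. *)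

(* Defs.v *)
From HB Require Import structures.
From mathcomp Require Import all_boot all_order all_algebra.
From mathcomp Require Import finmap monalg.
From mathcomp Require Import boolp classical_sets cardinality fsbigop.

Set Implicit Arguments.
Unset Strict Implicit.
Unset Printing Implicit Defensive.

Import GRing.Theory.
Local Open Scope ring_scope.
Local Open Scope classical_set_scope.

(* A power series in a central variable t is its sequence of coefficients.    *)
Section PowerSeries.
Variable R : nzRingType.
Implicit Types f g h : nat -> R.

Definition ps_one : nat -> R := fun n => (n == 0%N)%:R.

Definition ps_mul f g : nat -> R := fun n => \sum_(i < n.+1) f i * g (n - i)%N.

(* [:: g (n-1); ...; g 0] where g = f^-1, for f with constant term 1.         *)
Fixpoint ps_inv_coefs f (n : nat) : seq R :=
  if n is m.+1 then
    let s := ps_inv_coefs f m in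
    ((m == 0%N)%:R - \sum_(i < m) f i.+1 * s`_i) :: s
  else [::].

Definition ps_inv f : nat -> R := fun n => (ps_inv_coefs f n.+1)`_0.

Lemma size_ps_inv_coefs f n : size (ps_inv_coefs f n) = n.
Proof. by elim: n => //= n ->. Qed.

Lemma nth_ps_inv_coefs f n i :
  (i < n)%N -> (ps_inv_coefs f n)`_i = ps_inv f (n - i.+1)%N.
Proof.
elim: n i => // n IHn [|i] lt_in; first by rewrite subn1.
by rewrite [LHS]/= IHn.
Qed.

Lemma ps_mulV f : f 0%N = 1 -> ps_mul f (ps_inv f) = ps_one.
Proof.
move=> f0; apply/funext => n; rewrite /ps_mul big_ord_recl f0 mul1r subn0.
rewrite {1}/ps_inv /= /ps_one.
rewrite (eq_bigr (fun i : 'I_n => f i.+1 * ps_inv f (n - i.+1)%N)).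
  by rewrite subrK.
by move=> i _; rewrite nth_ps_inv_coefs.
Qed.

Lemma ps_mul_poly f g n k : (k <= n)%N ->
  ps_mul f g k = ((\poly_(i < n.+1) f i) * (\poly_(i < n.+1) g i))`_k.
Proof.
move=> le_kn; rewrite coefM; apply: eq_bigr => i _; rewrite !coef_poly !ltnS.
by rewrite (leq_trans _ le_kn) 1?(leq_trans _ le_kn) ?leq_subr // -ltnS.
Qed.

Lemma ps_mulA f g h : ps_mul f (ps_mul g h) = ps_mul (ps_mul f g) h.
Proof.
apply/funext => n; pose P f := \poly_(i < n.+1) f i.
transitivity ((P f * (P g * P h))`_n); last rewrite mulrA.
  rewrite coefM; apply: eq_bigr => i _.
  by rewrite coef_poly ltn_ord (@ps_mul_poly _ _ n) ?leq_subr.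
rewrite coefM; apply: eq_bigr => i _.
by rewrite coef_poly ltnS leq_subr (@ps_mul_poly _ _ n) // -ltnS.
Qed.

Lemma ps_mul1 f : ps_mul f ps_one = f.
Proof.
apply/funext => n; rewrite /ps_mul big_ord_recr /= subnn mulr1 big1 ?add0r //.
by move=> i _; rewrite /ps_one subn_eq0 leqNgt ltn_ord mulr0.
Qed.

Lemma ps_1mul f : ps_mul ps_one f = f.
Proof.
apply/funext => n; rewrite /ps_mul big_ord_recl /= subn0 mul1r big1 ?addr0 //.
by move=> i _; rewrite mul0r.
Qed.

HB.instance Definition _ :=
  Monoid.isLaw.Build (nat -> R) ps_one ps_mul ps_mulA ps_1mul ps_mul1.

Lemma ps_mulVl f : f 0%N = 1 -> ps_mul (ps_inv f) f = ps_one.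
Proof.
move=> f0; have g0 : ps_inv f 0%N = 1 by rewrite /ps_inv /= big_ord0 subr0.
have fg := ps_mulV f0; have gh := ps_mulV g0.
by rewrite -{2}[f]ps_mul1 -gh (ps_mulA f) fg ps_1mul gh.
Qed.

(* The factor 1 - t^k x.                                                      *)
Definition ps_one_sub (k : nat) (x : R) : nat -> R :=
  fun n => (n == 0%N)%:R - (if n == k then x else 0).

(* 1/(1 - t Q_1) * 1/(1 - t^2 Q_2) * ... * 1/(1 - t^N Q_N), in this order     *)
Definition ps_partial_prod (Q : nat -> R) (N : nat) : nat -> R :=
  \big[ps_mul/ps_one]_(1 <= k < N.+1) ps_inv (ps_one_sub k (Q k)).

(* Convergence of the infinite product is coefficientwise (t-adic).           *)
Definition is_infinite_prod (Q S : nat -> R) : Prop :=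
  forall n, exists N0, forall N, (N0 <= N)%N -> ps_partial_prod Q N n = S n.

Lemma ps_inv_one_subE k x n : (0 < k)%N -> (n <= k)%N ->
  ps_inv (ps_one_sub k x) n = (n == 0%N)%:R + (if n == k then x else 0).
Proof.
move=> k0; set f := ps_one_sub k x.
have f0 : f 0%N = 1 by rewrite /f /ps_one_sub eqxx ltn_eqF // subr0.
have low m : (m < k)%N -> ps_inv f m = (m == 0%N)%:R.
  move=> lt_mk; have := congr1 (@^~ m) (ps_mulV f0).
  rewrite /ps_mul big_ord_recl f0 mul1r subn0 big1 ?addr0 // => j _.
  rewrite /f /ps_one_sub /= [_ == k]ltn_eqF ?subrr ?mul0r //.
  exact: leq_ltn_trans (ltn_ord j) lt_mk.
rewrite leq_eqVlt => /predU1P[->|lt_nk]; last first.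
  by rewrite low // [_ == k]ltn_eqF ?addr0.
have := congr1 (@^~ k) (ps_mulV f0).
rewrite /ps_mul big_ord_recl f0 mul1r subn0.
case: k k0 @f f0 low => // k _ f f0 low; rewrite big_ord_recr /= subnn.
rewrite [X in _ + (X + _)]big1 => [|j _]; last first.
  rewrite /f /ps_one_sub /= /bump /= add1n eqSS.
  by rewrite [_ == k]ltn_eqF ?subrr ?mul0r.
rewrite add0r (low 0) // mulr1 eqxx {2}/f /ps_one_sub eqxx /= sub0r /ps_one /=.
by move/subr0_eq ->; rewrite add0r.
Qed.

Lemma ps_partial_prodS Q N n : (n <= N.+1)%N ->
  ps_partial_prod Q N.+1 n =
  ps_partial_prod Q N n + (if n == N.+1 then Q n else 0).
Proof.
have P0 M : ps_partial_prod Q M 0%N = 1.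
  rewrite /ps_partial_prod; elim: M => [|M IHM]; first by rewrite big_nil.
  by rewrite big_nat_recr //= /ps_mul big_ord1 IHM mul1r ps_inv_one_subE ?addr0.
move=> le_nN; rewrite {1}/ps_partial_prod big_nat_recr //=.
rewrite -/(ps_partial_prod Q N) /ps_mul.
rewrite (eq_bigr (fun j : 'I_n.+1 =>
   ps_partial_prod Q N j * ((n - j)%N == 0%N)%:R
   + ps_partial_prod Q N j * (if (n - j)%N == N.+1 then Q N.+1 else 0))).
  rewrite big_split; congr (_ + _).
    exact: (congr1 (@^~ n) (ps_mul1 (ps_partial_prod Q N))).
  rewrite big_ord_recl /= subn0 P0 mul1r big1 ?addr0.
    by case: eqP => [->|].
  move=> j _; rewrite ltn_eqF ?mulr0 // (leq_trans _ le_nN) //.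
  by rewrite /= ltn_subrL (leq_ltn_trans _ (ltn_ord j)).
by move=> j _; rewrite -mulrDr ps_inv_one_subE // (leq_trans (leq_subr _ _)).
Qed.

Lemma is_infinite_prodP Q S : S 0%N = 1 -> is_infinite_prod Q S <->
  forall n, S n.+1 = ps_partial_prod Q n n.+1 + Q n.+1.
Proof.
have stable n d : ps_partial_prod Q (n + d) n = ps_partial_prod Q n n.
  elim: d => [|d IHd]; first by rewrite addn0.
  have lt_n : (n < (n + d).+1)%N by rewrite ltnS leq_addr.
  by rewrite addnS ps_partial_prodS 1?ltnW // ltn_eqF // addr0.
have last n : ps_partial_prod Q n.+1 n.+1 = ps_partial_prod Q n n.+1 + Q n.+1.
  by rewrite ps_partial_prodS // eqxx.
move=> S0; split=> [QS n|QS n].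
  have [N0 /(_ (n.+1 + N0)%N (leq_addl _ _)) <-] := QS n.+1.
  by rewrite stable last.
exists n => N /subnKC <-; rewrite stable; case: n => [|n].
  by rewrite /ps_partial_prod big_nil S0.
by rewrite last QS.
Qed.

Lemma eq_ps_partial_prod Q Q' N :
  (forall n, (0 < n <= N)%N -> Q n = Q' n) ->
  ps_partial_prod Q N = ps_partial_prod Q' N.
Proof. by move=> eqQ; apply: eq_big_nat => k /eqQ ->. Qed.

(* The sequence (Q_n)_(n >= 1) exists and is determined by S.                 *)
Lemma infinite_prod_uniq Q Q' S : S 0%N = 1 ->
  is_infinite_prod Q S -> is_infinite_prod Q' S ->
  forall n, (0 < n)%N -> Q n = Q' n.
Proof.
move=> S0 /(is_infinite_prodP _ S0) QS /(is_infinite_prodP _ S0) Q'S n.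
elim/ltn_ind: n => -[|n] // IHn _; have := QS n; rewrite Q'S.
rewrite (eq_ps_partial_prod (Q := Q) (Q' := Q')) => [/addrI //|m /andP[m0 mn]].
exact: IHn.
Qed.

Lemma infinite_prod_exists S : S 0%N = 1 -> exists Q, is_infinite_prod Q S.
Proof.
move=> S0; pose q := fix q n := if n is m.+1 then
  rcons (q m) (S m - ps_partial_prod (nth 0 (q m)) m.-1 m) else [::].
have size_q n : size (q n) = n by elim: n => //= n IHn; rewrite size_rcons IHn.
pose Q n := nth 0 (q n.+1) n.
have qE n m : (m < n)%N -> nth 0 (q n) m = Q m.
  elim: n => // n IHn; rewrite ltnS leq_eqVlt => /predU1P[-> //|lt_mn].
  by rewrite /= nth_rcons size_q lt_mn IHn.
exists Q; apply/is_infinite_prodP => // n.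
rewrite {2}/Q /= nth_rcons size_rcons size_q ltnn eqxx.
rewrite (eq_ps_partial_prod (Q := nth 0 (rcons (q n) _)) (Q' := Q)).
  by rewrite addrC subrK.
by move=> m /andP[_ le_mn]; rewrite -(qE n.+1).
Qed.

End PowerSeries.

(* Sym = Q<Lambda_1, Lambda_2, ...>, the monoid algebra of the free monoid;
   its generator k : nat stands for Lambda_(k+1).                             *)
Notation Sym := {malg rat[{fmonom nat}]}.

Definition Lambda (n : nat) : Sym := if n is k.+1 then << fmu k >> else 1.

Definition complete : nat -> Sym := ps_inv (fun k => (-1) ^+ k * Lambda k).

(* The value Q 0 is irrelevant.                                               *)
Definition is_Witt (Q : nat -> Sym) : Prop := is_infinite_prod Q complete.

Lemma complete0 : complete 0%N = 1.
Proof. by rewrite /complete /ps_inv /= big_ord0 subr0. Qed.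

Lemma Witt_exists : exists Q, is_Witt Q.
Proof. exact: infinite_prod_exists complete0. Qed.

Lemma Witt_uniq Q Q' : is_Witt Q -> is_Witt Q' ->
  forall n, (0 < n)%N -> Q n = Q' n.
Proof. exact: infinite_prod_uniq complete0. Qed.

Definition tLambda (n : nat) : Sym := (-1) ^+ n.+1 * Lambda n.

(* The algebra Q<bLambda> on the alphabet bLambda; the letter k : nat stands
   for tLambda (k+1).                                                         *)
Notation QLambda := {malg rat[{fmonom nat}]}.

Definition spec_word (w : {fmonom nat}) : QLambda :=
  \prod_(k <- w) ((-1) ^+ k * << fmu k >>).

(* x |-> x[bLambda], the algebra morphism sending Lambda_n to
   (-1)^(n-1) times the letter of index n.                                    *)
Definition spec (x : Sym) : QLambda := mmap malgC spec_word x.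

Lemma spec_word_mmorphism : mmorphism spec_word.
Proof.
by split=> [u v|]; rewrite /spec_word ?fm1 ?big_nil // fmM big_cat.
Qed.

HB.instance Definition _ :=
  isMultiplicative.Build _ _ spec_word spec_word_mmorphism.

Lemma specZ c x : spec (c *: x) = c *: spec x.
Proof. by rewrite /spec mmapZ mul_malgC. Qed.

Lemma specD : {morph spec : x y / x + y}.
Proof. exact: mmapD. Qed.

Lemma specM : {morph spec : x y / x * y}.
Proof.
have [|//] := @commr_mmap_is_multiplicative _ _ _ malgC spec_word.
move=> x u v; rewrite /GRing.comm !malgM_def fgmulUg fgmulgU.
by apply: eq_bigr => k _; rewrite mul1m mulm1 mulrC.
Qed.

Lemma spec1 : spec 1 = 1.
Proof. exact: mmap1. Qed.

Lemma spec_Lambda n : spec (Lambda n.+1) = (-1) ^+ n * << fmu n >>.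
Proof. by rewrite /spec mmapU mul1r /spec_word fmU big_seq1. Qed.

(* A word over bLambda, as a monomial of Sym.                                 *)
Definition word_val (w : {fmonom nat}) : Sym := \prod_(k <- w) tLambda k.+1.

(* The characteristic series of a set of words, given by its coefficients.    *)
Definition char_series (B : choiceType) (C : set {fmonom B}) :
  {fmonom B} -> rat := fun w => (`[< C w >])%:R.

Section WeightFactorization.
Variables (B : choiceType) (omega : B -> nat).
Implicit Types (A D : set {fmonom B}).

Definition letters : set {fmonom B} := range (@fmu B).

Definition weight (w : {fmonom B}) : nat := (\sum_(b <- w) omega b)%N.

Definition of_weight (i : nat) : set {fmonom B} := [set w | weight w = i].

Definition concat A D : set {fmonom B} := [set mmul u v | u in A & v in D].

Definition star A : set {fmonom B} :=
  [set w | exists2 us : seq {fmonom B},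
     (forall u, u \in us -> A u) & w = \big[mmul/mone]_(u <- us) u].

(* Indexed from 1: codeZ 0 and codeD 0 are junk, and empty.                   *)
Fixpoint codeZ (i : nat) : set {fmonom B} :=
  match i with
  | 0 => set0
  | 1 => letters
  | (_.+1 as j).+1 =>
      concat (codeZ j `\` (codeZ j `&` of_weight j))
             (star (codeZ j `&` of_weight j))
  end.

Definition codeD (i : nat) : set {fmonom B} := codeZ i `&` of_weight i.

Definition nonempty_codes (N : nat) : seq (set {fmonom B}) :=
  [seq codeD i | i <- iota 1 N & `[< codeD i !=set0 >]].

Lemma nonempty_codes_prefix M N : (M <= N)%N ->
  prefix (nonempty_codes M) (nonempty_codes N).
Proof.
move=> /subnKC <-; rewrite /nonempty_codes iotaD filter_cat map_cat.
exact: prefix_prefix.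
Qed.

(* The i-th term (from 1) of the sequence left after omitting the empty sets,
   or None if that sequence has fewer than i terms.                          *)
Definition factorization (i : nat) : option (set {fmonom B}) :=
  match pselect (exists N, (i <= size (nonempty_codes N))%N) with
  | left ex => onth (nonempty_codes (ex_minn ex)) i.-1
  | right _ => None
  end.

Lemma factorizationP i C : (0 < i)%N ->
  factorization i = Some C <->
  exists N, onth (nonempty_codes N) i.-1 = Some C.
Proof.
case: i => // i _; rewrite /factorization.
case: pselect => [ex|noN]; last first.
  split=> // -[N iC]; case: noN; exists N; rewrite ltnNge; apply/negP => le_i.
  by move: iC; rewrite /= onth_default.
case: ex_minnP => M lt_iM minM; split=> [<-|[N iC]]; first by exists M.
have lt_iN : (i < size (nonempty_codes N))%N.
  by rewrite ltnNge; apply/negP => le_i; move: iC; rewrite /= onth_default.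
have /prefixP[s Ns] := nonempty_codes_prefix (minM _ lt_iN).
by rewrite -iC Ns /= onth_cat lt_iM.
Qed.

End WeightFactorization.

(* Main.v *)
Require Import Defs.
From HB Require Import structures.
From mathcomp Require Import all_boot all_order all_algebra.
From mathcomp Require Import finmap monalg.
From mathcomp Require Import boolp classical_sets cardinality fsbigop.
From mathcomp Require Import functions.

(** Write 1/(1-f) for the geometric series of a power series f without constant
    term.  The theorem is Lazard elimination read off at the level of series:
    if d is the part of weight i of z, and y = (z-d) * 1/(1-d), then
    1 - z = (1-y)(1-d), hence 1/(1-z) = 1/(1-d) * 1/(1-y)
    ([geom_eliminate]).  Starting from the series z_1 of the alphabet and
    eliminating the weights 1, 2, 3, ... in turn gives series z_1, z_2, ... with
    z_N of order at least N, so that 1/(1-z_1) is the infinite product of the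
    1/(1-d_i), where d_i is the part of weight i of z_i
    ([geom_infinite_prod]).  The specialization of the generating series of the
    S_n is exactly 1/(1-z_1) ([spec_complete]); since the infinite product
    determines its factors, the specialization of Q_i is d_i.

    It remains to see that z_i is the characteristic series of the code Z_i,
    which is built from Z_1 by the same operations, concatenation replacing
    product and star replacing geometric series.  Two facts suffice, and no
    unique factorization argument for the Z_i is made.  First, all coefficients
    are natural numbers, so nothing cancels and the support of a product or of
    a geometric series is the concatenation or the star of the supports
    ([counts_elim_series]).  Second, z_i is bounded coefficientwise by
    1/(1-z_i), itself bounded by 1/(1-z_1), whose coefficients are at most 1
    because a word reads as a product of letters in one way only
    ([mult_free_elim_series], [mult_free_words]).  A natural number which is at
    most 1 is determined by its being zero or not ([counts_char_series]).

    No code is empty, the letter of weight i being in the i-th one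
    ([letter_codeZ]), so that omitting empty codes shifts no index.  Finally
    specialization is an involution, once words over the alphabet are identified
    with monomials, which turns the description of the specialized Q_i into
    that of Q_i itself ([specK], [word_valE]). *)

Set Implicit Arguments.
Unset Strict Implicit.
Unset Printing Implicit Defensive.

Import Order.TTheory GRing.Theory Num.Theory.

Local Open Scope ring_scope.
Local Open Scope classical_set_scope.

(** * Geometric series and elimination *)

Section GeometricSeries.
Variable R : nzRingType.
Implicit Types f g h d z : nat -> R.

Lemma ps_mulBl f g h : ps_mul (f - g) h = ps_mul f h - ps_mul g h.
Proof.
apply/funext => n; rewrite !fctE /ps_mul -sumrB.
by apply: eq_bigr => i _; rewrite -mulrBl.
Qed.

Lemma ps_mulBr f g h : ps_mul f (g - h) = ps_mul f g - ps_mul f h.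
Proof.
apply/funext => n; rewrite !fctE /ps_mul -sumrB.
by apply: eq_bigr => i _; rewrite -mulrBr.
Qed.

Lemma ps_inv_uniq f g : f 0%N = 1 -> ps_mul f g = @ps_one R -> g = ps_inv f.
Proof.
move=> f0 fg; rewrite -[g]ps_1mul -(@ps_mulVl _ f f0) -ps_mulA fg.
exact: ps_mul1.
Qed.

Lemma ps_partial_prod_recr Q N : ps_partial_prod Q N.+1 =
  ps_mul (ps_partial_prod Q N) (ps_inv (ps_one_sub N.+1 (Q N.+1 : R))).
Proof. by rewrite /ps_partial_prod big_nat_recr. Qed.

Definition geom f : nat -> R := ps_inv (@ps_one R - f).

Definition low_part m f : nat -> R := fun n => if n == m then f n else 0.

Section NoConstantTerm.
Variable f : nat -> R.
Hypothesis f0 : f 0%N = 0.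

Lemma one_sub0 : (@ps_one R - f) 0%N = 1.
Proof. by rewrite !fctE f0 subr0. Qed.

Lemma geom_eql : geom f = @ps_one R + ps_mul f (geom f).
Proof.
have := ps_mulV one_sub0; rewrite -/(geom f) ps_mulBl ps_1mul.
by move/eqP; rewrite subr_eq => /eqP.
Qed.

Lemma geom_eqr : geom f = @ps_one R + ps_mul (geom f) f.
Proof.
have := ps_mulVl one_sub0; rewrite -/(geom f) ps_mulBr ps_mul1.
by move/eqP; rewrite subr_eq => /eqP.
Qed.

Lemma geom0 : geom f 0%N = 1.
Proof. by rewrite geom_eql !fctE /ps_mul big_ord1 f0 mul0r addr0. Qed.

Lemma geom_low N n : (forall k, (k <= N)%N -> f k = 0) -> (n <= N)%N ->
  geom f n = ps_one R n.
Proof.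
move=> fN le_nN; rewrite geom_eql !fctE /ps_mul big1 ?addr0 // => i _.
by rewrite fN ?mul0r // (leq_trans _ le_nN) // -ltnS.
Qed.

End NoConstantTerm.

Lemma low_part0 m f : f 0%N = 0 -> low_part m f 0%N = 0.
Proof. by move=> f0; rewrite /low_part; case: ifP. Qed.

Lemma eliminate0 z d : z 0%N = 0 -> d 0%N = 0 ->
  ps_mul (z - d) (geom d) 0%N = 0.
Proof. by move=> z0 d0; rewrite /ps_mul big_ord1 !fctE z0 d0 subr0 mul0r. Qed.

(** One step of Lazard elimination: with Y the complement of D in Z, the free
    monoid over Z is the product of those over D and over the words of Y
    followed by a product of words of D. *)
Lemma geom_eliminate z d : z 0%N = 0 -> d 0%N = 0 ->
  geom z = ps_mul (geom d) (geom (ps_mul (z - d) (geom d))).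
Proof.
move=> z0 d0; set y := ps_mul (z - d) _; pose one := @ps_one R.
have y0 : y 0%N = 0 := eliminate0 z0 d0.
have fact : ps_mul (one - y) (one - d) = one - z.
  rewrite ps_mulBl ps_1mul /y -ps_mulA ps_mulVl ?one_sub0 // ps_mul1.
  by rewrite opprB addrA subrK.
apply/esym/ps_inv_uniq; rewrite ?one_sub0 // -/one -fact -ps_mulA.
rewrite (ps_mulA (one - d)) ps_mulV ?one_sub0 // ps_1mul.
by rewrite ps_mulV ?one_sub0.
Qed.

(** Indices are shifted by one: with [f] the series of the alphabet,
    [elim_series f m] is the series of the code Z of index [m.+1]. *)
Fixpoint elim_series f m : nat -> R :=
  if m is k.+1 then
    let z := elim_series f k in
    let d := low_part k.+1 z in ps_mul (z - d) (geom d)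
  else f.

Lemma elim_series_low f m n : f 0%N = 0 -> (n <= m)%N -> elim_series f m n = 0.
Proof.
move=> f0; elim: m n => [|m IHm] n; first by rewrite leqn0 => /eqP ->.
move=> le_nm; rewrite /= /ps_mul big1 // => j _.
have: (j <= m.+1)%N by rewrite (leq_trans _ le_nm) // -ltnS.
rewrite !fctE /low_part leq_eqVlt => /predU1P[->|lt_jm].
  by rewrite eqxx subrr mul0r.
by rewrite ltn_eqF // subr0 IHm ?mul0r.
Qed.

(** The component eliminated at step [k], for [k] positive. *)
Definition elim_low f k : R := elim_series f k.-1 k.

Lemma geom_elim_series f N : f 0%N = 0 ->
  geom f = ps_mul (ps_partial_prod (elim_low f) N) (geom (elim_series f N)).
Proof.
move=> f0; elim: N => [|N IHN].
  by rewrite /ps_partial_prod big_nil ps_1mul.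
rewrite ps_partial_prod_recr -ps_mulA.
have z0 : elim_series f N 0%N = 0 by rewrite elim_series_low.
rewrite IHN (geom_eliminate z0 (low_part0 N.+1 z0)).
congr (ps_mul _ (ps_mul _ _)).
rewrite /geom; congr ps_inv; apply/funext => n.
rewrite !fctE /ps_one_sub /low_part.
by case: eqP => [->|].
Qed.

(** The remaining factor after N eliminations is 1 up to degree N, because the
    remaining series starts in degree N + 1. *)
Lemma geom_infinite_prod f :
  f 0%N = 0 -> is_infinite_prod (elim_low f) (geom f).
Proof.
move=> f0 n; exists n => N le_nN; rewrite (geom_elim_series N f0).
rewrite -{1}[ps_partial_prod _ N]ps_mul1; apply: eq_bigr => i _; congr (_ * _).
rewrite (@geom_low _ _ N) ?elim_series_low // => [k|].
  exact: elim_series_low.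
exact: leq_trans (leq_subr _ _) le_nN.
Qed.

End GeometricSeries.

Section Morphism.
Variables (R S : nzRingType) (phi : {rmorphism R -> S}).
Implicit Types f g : nat -> R.

Lemma rmorph_ps_one : phi \o ps_one R = ps_one S.
Proof. by apply/funext => n /=; rewrite rmorph_nat. Qed.

Lemma rmorph_ps_mul f g : phi \o ps_mul f g = ps_mul (phi \o f) (phi \o g).
Proof.
apply/funext => n; rewrite /= rmorph_sum.
by apply: eq_bigr => i _; rewrite rmorphM.
Qed.

Lemma rmorph_ps_inv f : f 0%N = 1 -> phi \o ps_inv f = ps_inv (phi \o f).
Proof.
move=> f0; apply: ps_inv_uniq; first by rewrite /= f0 rmorph1.
by rewrite -rmorph_ps_mul ps_mulV // rmorph_ps_one.
Qed.

Lemma rmorph_ps_partial_prod Q N :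
  phi \o ps_partial_prod Q N = ps_partial_prod (phi \o Q) N.
Proof.
elim: N => [|N IHN]; first by rewrite /ps_partial_prod !big_nil rmorph_ps_one.
rewrite !ps_partial_prod_recr rmorph_ps_mul IHN.
congr ps_mul; rewrite rmorph_ps_inv; last by rewrite /ps_one_sub subr0.
congr ps_inv; apply/funext => n; rewrite /= /ps_one_sub rmorphB rmorph_nat.
by case: ifP => _; rewrite ?rmorph0.
Qed.

Lemma rmorph_infinite_prod Q f :
  is_infinite_prod Q f -> is_infinite_prod (phi \o Q) (phi \o f).
Proof.
move=> Qf n; have [N0 fN] := Qf n; exists N0 => N /fN eq_f.
by rewrite -rmorph_ps_partial_prod /= eq_f.
Qed.

End Morphism.

(** * Series with multiplicities *)

(** [Num.nat_num_subdef] is the predicate behind [Num.nat]; it carries the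
    structure of a semiring-closed predicate which makes [monalgOver] closed
    under ring operations. *)
Notation natMalg := (monalgOver (@Num.nat_num_subdef rat)).

Section NaturalCoefficients.
Variable K : monomType.
Implicit Types (a b : {malg rat[K]}) (u v w : K).

Lemma natMalg_nat a w : a \is a natMalg -> a@_w \is a Num.nat.
Proof. by move/monalgOverP; apply. Qed.

Lemma natMalg_ge0 a w : a \is a natMalg -> 0 <= a@_w.
Proof. by move/natMalg_nat/natr_ge0; apply. Qed.

Lemma natMalgU u : << u >> \is a natMalg.
Proof. by apply/monalgOverP => w; rewrite mcoeffU1; apply: natr_nat. Qed.

Lemma msupp_natD a b w : a \is a natMalg -> b \is a natMalg ->
  (w \in msupp (a + b)) = (w \in msupp a) || (w \in msupp b).
Proof.
move=> /(natMalg_ge0 w) a0 /(natMalg_ge0 w) b0.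
by rewrite -!mcoeff_neq0 mcoeffD paddr_eq0 // negb_and.
Qed.

Lemma msupp_nat_sum (I : finType) (F : I -> {malg rat[K]}) w :
  (forall i, F i \is a natMalg) ->
  w \in msupp (\sum_i F i) <-> exists i, w \in msupp (F i).
Proof.
move=> natF; rewrite -mcoeff_neq0 raddf_sum psumr_neq0 => [|i _]; last first.
  exact: natMalg_ge0.
split=> [/hasP[i _ /= gt0]|[i wi]].
  by exists i; rewrite -mcoeff_neq0 gt_eqF.
apply/hasP; exists i; rewrite ?mem_index_enum //=.
by rewrite lt_def mcoeff_neq0 wi natMalg_ge0.
Qed.

(** Coefficients of the product are sums of nonnegative terms, so no pair of
    words of the supports is cancelled. *)
Lemma msupp_natM a b w : a \is a natMalg -> b \is a natMalg ->
  w \in msupp (a * b) <->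
  exists u v, [/\ u \in msupp a, v \in msupp b & w = mmul u v].
Proof.
move=> na nb; have ge0 u v : 0 <= a@_u * b@_v *+ (mmul u v == w).
  by rewrite mulrn_wge0 // mulr_ge0 // natMalg_ge0.
rewrite -mcoeff_neq0 mcoeffMl psumr_neq0 => [|u _]; last exact: sumr_ge0.
split=> [/hasP[u ua /= /lt0r_neq0]|[u [v [ua vb w_uv]]]].
  rewrite psumr_neq0 // => /hasP[v vb /= gt0]; exists u, v; split=> //.
  by case: eqP gt0 => // _; rewrite mulr0n ltxx.
apply/hasP; exists u => //=; rewrite lt_def sumr_ge0 // psumr_neq0 // andbT.
apply/hasP; exists v => //=.
by rewrite -w_uv eqxx mulr1n mulr_gt0 // lt_def mcoeff_neq0 ?ua ?vb natMalg_ge0.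
Qed.

End NaturalCoefficients.

Section Counting.
Variables (B : choiceType) (omega : B -> nat).
Local Notation R := {malg rat[{fmonom B}]}.
Local Notation wt := (weight omega).
Implicit Types (f g d : nat -> R) (A D : set {fmonom B}) (u v w : {fmonom B}).

Definition nat_series f := forall n, f n \is a natMalg.

(** The t-degree of a word is its weight, and [f] gives the words of [A], and no
    others, a positive multiplicity. *)
Definition counts f A :=
  nat_series f /\ forall n w, w \in msupp (f n) <-> A w /\ wt w = n.

Lemma weight1 : wt mone = 0%N.
Proof. by rewrite /weight fm1 big_nil. Qed.

Lemma weightM u v : wt (mmul u v) = (wt u + wt v)%N.
Proof. by rewrite /weight fmM big_cat. Qed.

Lemma weightU b : wt (fmu b) = omega b.
Proof. by rewrite /weight fmU big_seq1. Qed.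

Lemma nat_series_mul f g :
  nat_series f -> nat_series g -> nat_series (ps_mul f g).
Proof. by move=> nf ng n; apply: rpred_sum => i _; apply: rpredM. Qed.

Lemma msupp_ps_mul f g n w : nat_series f -> nat_series g ->
  w \in msupp (ps_mul f g n) <->
  exists i u v, [/\ (i <= n)%N, u \in msupp (f i), v \in msupp (g (n - i)%N)
                  & w = mmul u v].
Proof.
move=> nf ng; rewrite /ps_mul msupp_nat_sum => [|i]; last exact: rpredM.
split=> [[i /msupp_natM[//|//|u [v [ufi vgi ->]]]]|].
  by exists i, u, v; split=> //; rewrite -ltnS.
move=> [i [u [v [le_in ufi vgi ->]]]].
by exists (inord i); apply/msupp_natM => //; exists u, v; rewrite inordK.
Qed.

(** Unambiguity of the concatenation is not at stake: multiplicities only have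
    to be positive. *)
Lemma counts_mul f g A D :
  counts f A -> counts g D -> counts (ps_mul f g) (concat A D).
Proof.
move=> [nf fA] [ng gD]; split=> [|n w]; first exact: nat_series_mul.
rewrite msupp_ps_mul //.
split=> [[i [u [v [le_in /fA[Au ui] /gD[Dv vi] ->]]]]|].
  by split; [exists u => //; exists v|rewrite weightM ui vi subnKC].
move=> [[u Au [v Dv <-]]]; rewrite weightM => <-.
exists (wt u), u, v; split; rewrite ?leq_addr //; first exact/fA.
by rewrite addKn; apply/gD.
Qed.

Lemma nat_series_geom d : d 0%N = 0 -> nat_series d -> nat_series (geom d).
Proof.
move=> d0 nd; elim/ltn_ind => n IHn.
rewrite geom_eql // !fctE rpredD ?rpred_nat //.
rewrite rpred_sum // => -[i lt_in] _.
case: i lt_in => [|i] lt_in; first by rewrite d0 mul0r rpred0.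
by rewrite rpredM // IHn // ltn_subrL (leq_trans _ (lt_in : (i < n)%N)).
Qed.

Lemma msupp_geom d n w : d 0%N = 0 -> nat_series d ->
  w \in msupp (geom d n) <->
  (n = 0%N /\ w = mone) \/ w \in msupp (ps_mul d (geom d) n).
Proof.
move=> d0 nd; have ng := nat_series_geom d0 nd.
rewrite {1}geom_eql // !fctE msupp_natD ?rpred_nat //; last first.
  exact: nat_series_mul.
rewrite -mcoeff_neq0 /ps_one; case: n => [|n]; last first.
  by rewrite mcoeff0 eqxx /=; split=> [|[[]|]] //; right.
rewrite mcoeff1 pnatr_eq0 eqb0 negbK; case: (eqVneq w mone) => [->|neq] /=.
  by split=> // _; left.
split=> [wd|[[_ w1]|//]]; first by right.
by rewrite w1 eqxx in neq.
Qed.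

(** Both inclusions follow from 1/(1-d) = 1 + d * 1/(1-d), which peels off the
    first factor of a decomposition over [D]; that factor has positive weight
    as [d] has no constant term. *)
Lemma counts_geom d D : d 0%N = 0 -> counts d D -> counts (geom d) (star D).
Proof.
move=> d0 [nd dD]; have ng := nat_series_geom d0 nd; split=> // n w; split.
  elim/ltn_ind: n w => n IHn w /(msupp_geom _ _ d0 nd)[[-> ->]|].
    by split; [exists [::]; rewrite ?big_nil|exact: weight1].
  case/msupp_ps_mul => // -[|i] [u [v [le_in]]]; first by rewrite d0 msupp0 inE.
  move=> /dD[Du ui] /IHn[|[us usD ->] vi ->].
    by rewrite ltn_subrL (leq_trans _ le_in).
  split; last by rewrite weightM ui vi subnKC.
  exists (u :: us); last by rewrite big_cons.
  by move=> x; rewrite inE => /predU1P[->|/usD].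
move=> [[us usD ->] <-]; elim: us usD => [|u us IHus] usD.
  by apply/(msupp_geom _ _ d0 nd); left; rewrite big_nil weight1.
have Du : D u by apply: usD; rewrite inE eqxx.
apply/(msupp_geom _ _ d0 nd); right; apply/msupp_ps_mul => //.
set v := \big[_/_]_(_ <- us) _ in IHus.
exists (wt u), u, v; rewrite big_cons -/v weightM addKn leq_addr; split=> //.
  exact/dD.
by apply: IHus => x xus; apply: usD; rewrite inE xus orbT.
Qed.

Lemma counts_low_part f A m :
  counts f A -> counts (low_part m f) (A `&` of_weight omega m).
Proof.
move=> [nf fA]; split=> [n|n w]; rewrite /low_part.
  by case: ifP => _; rewrite ?rpred0.
case: eqP => [->|neq]; last first.
  by rewrite msupp0 inE; split=> // -[[_ /= wm] wn]; rewrite -wn -wm in neq.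
by rewrite fA; split=> [[Aw wm]|[[]]].
Qed.

Lemma counts_sub_low_part f A m : counts f A ->
  counts (f - low_part m f) (A `\` (A `&` of_weight omega m)).
Proof.
move=> [nf fA]; split=> [n|n w]; rewrite !fctE /low_part.
  by case: ifP => _; rewrite ?subrr ?subr0 ?rpred0.
case: eqP => [->|neq].
  by rewrite subrr msupp0 inE; split=> // -[[Aw notm] wm]; case: notm.
rewrite subr0 fA; split=> [[Aw wn]|[[Aw _]] //]; split=> //; split=> // -[_].
by move=> /= wm; rewrite -wn -wm in neq.
Qed.

Lemma counts_elim_series f m : f 0%N = 0 -> counts f (@letters B) ->
  counts (elim_series f m) (codeZ omega m.+1).
Proof.
move=> f0 fA; elim: m => // m IHm; apply: counts_mul.
  exact: counts_sub_low_part.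
apply: counts_geom; last exact: counts_low_part.
by apply: low_part0; apply: elim_series_low.
Qed.

(** * Multiplicities are bounded by one *)

Definition mult_free f := forall n w, (f n)@_w <= 1.

(** Coefficientwise g <= f * g as soon as f - 1 has nonnegative coefficients. *)
Lemma mult_free_mulr f g : nat_series f -> nat_series g -> f 0%N = 1 ->
  mult_free (ps_mul f g) -> mult_free g.
Proof.
move=> nf ng f0 fg n w; apply: le_trans (fg n w).
rewrite /ps_mul big_ord_recl f0 mul1r subn0 mcoeffD lerDl natMalg_ge0 //.
by apply: rpred_sum => i _; apply: rpredM.
Qed.

(** Coefficientwise f <= 1/(1-f). *)
Lemma mult_free_geom f : nat_series f -> f 0%N = 0 ->
  mult_free (geom f) -> mult_free f.
Proof.
move=> nf f0 free n w; apply: le_trans (free n w).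
have ng := nat_series_geom f0 nf.
rewrite geom_eqr // !fctE mcoeffD ler_wpDl //.
  by rewrite natMalg_ge0 // rpred_nat.
rewrite /ps_mul big_ord_recl geom0 // mul1r subn0 mcoeffD lerDl natMalg_ge0 //.
by apply: rpred_sum => i _; apply: rpredM.
Qed.

(** Each 1/(1-z_i) is a right factor of 1/(1-z_1), with a left factor of
    constant term 1 and natural coefficients, hence is bounded by
    1/(1-z_1). This is what makes the products defining the codes unambiguous. *)
Lemma mult_free_elim_series f m : f 0%N = 0 -> counts f (@letters B) ->
  mult_free (geom f) -> mult_free (elim_series f m).
Proof.
move=> f0 fA free.
have z0 k : elim_series f k 0%N = 0 by rewrite elim_series_low.
have nz k : nat_series (elim_series f k) := (counts_elim_series k f0 fA).1.
apply: (mult_free_geom (nz m) (z0 m)); elim: m => [//|m IHm].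
have d0 := low_part0 m.+1 (z0 m).
apply: (@mult_free_mulr (geom (low_part m.+1 (elim_series f m)))).
- apply: nat_series_geom d0 _.
  exact: (counts_low_part m.+1 (counts_elim_series m f0 fA)).1.
- exact: nat_series_geom (z0 m.+1) (nz m.+1).
- exact: geom0 d0.
- by rewrite -(geom_eliminate (z0 m) d0).
Qed.

Lemma counts_char_series f A n w : counts f A -> mult_free f ->
  (f n)@_w = char_series (A `&` of_weight omega n) w.
Proof.
move=> [nf fA] free; rewrite /char_series; case: asboolP => [Aw|notAw].
  have: (f n)@_w != 0 by rewrite mcoeff_neq0; apply/fA.
  have := free n w; have /natrP[[|[|k]] ->] := natMalg_nat w (nf n).
  - by rewrite eqxx.
  - by [].
  - by rewrite lern1.
by apply/eqP; rewrite mcoeff_eq0; apply/negP => /fA.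
Qed.

End Counting.

(** * The alphabet of signed elementary functions *)

HB.instance Definition _ := GRing.isZmodMorphism.Build Sym QLambda spec
  (fun x y => raddfB (mmap malgC spec_word) x y).
HB.instance Definition _ :=
  GRing.isMonoidMorphism.Build Sym QLambda spec (spec1, specM).

Lemma prod_letters (w : {fmonom nat}) :
  \prod_(k <- w) << fmu k >> = << w >> :> QLambda.
Proof.
case: w => s; rewrite -[X in \prod_(k <- X) _]/s.
elim: s => [|k s IHs]; first by rewrite big_nil -fmoneE.
rewrite big_cons IHs malgM_def fgmulUU mulr1; congr << _ >>.
by apply/eqP; rewrite fmP fmM fmU.
Qed.

Lemma spec_spec_word w : spec (spec_word w) = << w >>.
Proof.
rewrite rmorph_prod -prod_letters; apply: eq_bigr => k _.
rewrite rmorphM rmorph_sign [X in _ * X](spec_Lambda k).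
by rewrite mulrA -exprD addnn -mul2n exprM sqrrN !expr1n mul1r.
Qed.

Lemma specE x : spec x = \sum_(w <- msupp x) x@_w *: spec_word w.
Proof. by rewrite /spec mmapE; apply: eq_bigr => w _; rewrite mul_malgC. Qed.

(** On the generator of degree k + 1 the morphism is multiplication by (-1)^k,
    letters and generators being named by the same monomials. *)
Lemma specK : involutive spec.
Proof.
move=> x; rewrite (specE x) rmorph_sum [RHS]monalgE.
apply: eq_bigr => w _; rewrite [LHS]specZ spec_spec_word.
by apply/malgP => v; rewrite mcoeffZ !mcoeffU mulr_natr.
Qed.

Lemma word_valE w : word_val w = spec_word w.
Proof. by apply: eq_bigr => k _; rewrite /tLambda !exprS !mulN1r opprK. Qed.

Definition letter_series (n : nat) : QLambda :=
  if n is k.+1 then << fmu k >> else 0.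

Lemma spec_complete : spec \o complete = geom letter_series.
Proof.
pose f k := (-1) ^+ k * Lambda k; have f0 : f 0%N = 1 by rewrite /f mul1r.
rewrite [LHS](rmorph_ps_inv spec f0) /geom; congr ps_inv.
rewrite {f0}/f; apply/funext => -[|k] /=.
  by rewrite mul1r spec1 !fctE subr0.
rewrite rmorphM rmorph_sign [X in _ * X](spec_Lambda k) exprS mulN1r mulNr.
rewrite mulrA -exprD addnn -mul2n exprM sqrrN !expr1n mul1r.
by rewrite !fctE sub0r.
Qed.

Lemma counts_letter_series : counts succn letter_series (@letters nat).
Proof.
split=> [[|k]|[|k] w] /=; rewrite ?rpred0 ?natMalgU //.
  by rewrite msupp0 inE; split=> // -[[b _ <-]]; rewrite weightU.
rewrite msuppU1 in_fset1; split=> [/eqP ->|[[b _ <-]]].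
  by rewrite weightU; split=> //; exists k.
by rewrite weightU => -[->].
Qed.

Lemma mcoeff_letterM k (g : QLambda) (w : {fmonom nat}) :
  (<< fmu k >> * g)@_w =
  if (w : seq nat) is j :: s then (if k == j then g@_(FMonom s) else 0) else 0.
Proof.
have ->: (<< fmu k >> * g)@_w =
    \sum_(v <- msupp g) g@_v *+ (k :: (v : seq nat) == w :> seq nat).
  rewrite malgM_def fgmulUg raddf_sum; apply: eq_bigr => v _ /=.
  by rewrite mcoeffU mul1r fmP fmM fmU.
case: w => -[|j s] /=; first by rewrite big1.
under eq_bigr do rewrite eqseq_cons.
case: eqVneq => _ /=; last by rewrite big1.
rewrite {3}[g]monalgE raddf_sum; apply: eq_bigr => v _ /=.
by rewrite mcoeffU fmP.
Qed.

(** The first letter of a word determines the only term of z * 1/(1-z), for z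
    the series of the alphabet, in which the word occurs. *)
Lemma mult_free_words : mult_free (geom letter_series).
Proof.
elim/ltn_ind => -[|n] IHn w.
  by rewrite geom0 // mcoeff1 lern1 leq_b1.
rewrite geom_eql // !fctE add0r /ps_mul big_ord_recl mul0r add0r raddf_sum /=.
under eq_bigr do rewrite add0n subSS mcoeff_letterM.
case: w => -[|j s] /=; first by rewrite big1 ?ler01.
rewrite -big_mkcond /=; have [le_jn|lt_nj] := leqP j n; last first.
  rewrite big1 ?ler01 // => i /eqP ij.
  by move: (ltn_ord i); rewrite ij ltnS leqNgt lt_nj.
rewrite (big_pred1 (Ordinal (le_jn : (j < n.+1)%N))) => [|i] //.
by rewrite IHn // ltnS leq_subr.
Qed.

(** A letter survives all the eliminations of weights smaller than its own,
    being followed by the empty product of eliminated words. *)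
Lemma letter_codeZ k j : (j <= k)%N -> codeZ succn j.+1 (fmu k).
Proof.
elim: j => [|j IHj] lt_jk; first by exists k.
exists (fmu k).
  split; first exact/IHj/ltnW.
  move=> [_]; rewrite /of_weight /= weightU => -[kj].
  by rewrite kj ltnn in lt_jk.
exists mone; last exact: mulm1.
by exists [::]; rewrite ?big_nil.
Qed.

Lemma codeD_neq0 i : (0 < i)%N -> codeD succn i !=set0.
Proof.
case: i => // k _; exists (fmu k).
by split; [exact: letter_codeZ|exact: weightU].
Qed.

Lemma factorization_codeD i :
  (0 < i)%N -> factorization succn i = Some (codeD succn i).
Proof.
case: i => // k _; apply/factorizationP => //; exists k.+1.
rewrite /nonempty_codes (@eq_in_filter _ _ predT) => [|j]; last first.
  by rewrite mem_iota => /andP[j0 _]; apply/asboolP/codeD_neq0.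
rewrite filter_predT onth_map onthE (nth_map 0%N) ?size_iota //.
by rewrite nth_iota.
Qed.

Theorem theorem3 (Q : nat -> Sym) (hQ : is_Witt Q) (i : nat) (hi : (0 < i)%N) :
  exists C : set {fmonom nat},
    [/\ factorization succn i = Some C,
        (forall w : {fmonom nat}, (spec (Q i))@_w = char_series C w),
        finite_set C
      & Q i = \sum_(w \in C) word_val w].
Proof.
have specQ : spec (Q i) = elim_low letter_series i.
  have specP : is_infinite_prod (spec \o Q) (geom letter_series).
    by rewrite -spec_complete; apply: (rmorph_infinite_prod spec hQ).
  have l0 : letter_series 0%N = 0 by [].
  exact: (infinite_prod_uniq (geom0 l0) specP (geom_infinite_prod l0) hi).
have coefQ w : (spec (Q i))@_w = char_series (codeD succn i) w.
  rewrite specQ; case: i hi {specQ} => // k _.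
  have l0 : letter_series 0%N = 0 by [].
  have cL := counts_letter_series.
  exact: counts_char_series (counts_elim_series k l0 cL)
           (mult_free_elim_series k l0 cL mult_free_words).
have codeE : codeD succn i = [set` msupp (spec (Q i))].
  apply/seteqP; split=> w /=; rewrite -mcoeff_neq0 coefQ /char_series.
    by move=> Dw; rewrite asboolT // oner_eq0.
  by case: asboolP => //; rewrite eqxx.
exists (codeD succn i); split=> //; first exact: factorization_codeD.
  by rewrite codeE; apply: finite_seq.
rewrite codeE -fsbig_seq //= -{1}[Q i]specK specE !big_seq.
apply: eq_bigr => w wQ; rewrite word_valE coefQ /char_series.
by rewrite asboolT ?scale1r // codeE.
Qed.
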